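(* Suppose that the initial-boundary value problem $$u_\tau-\tfrac12\sigma^2S^2u_{SS}+a e^{u}e^{-v}-b=0,\qquad v_\tau+c\,e^{v}e^{-u}-c=0\qquad\text{on } Q_T=[0,T]\times[0,S_{\max}],$$ $$u(0,S)=v(0,S)=\gamma h(S)\ (0\le S\le S_{\max}),\qquad u(\tau,0)=\varphi_l(\tau),\quad u(\tau,S_{\max})=\varphi_r(\tau)\ (0\le\tau\le T),$$ has a classical solution $(u,v)$ with $u,v\in C^{2,4}(Q_T)$. For a mesh with steps $\triangle S,\triangle\tau$, let $(U,V)$ be the grid functions determined by the implicit-explicit linear scheme $$\frac{U_i^{j+1}-U_i^j}{\triangle\tau}-\frac12\sigma^2S_i^2\,\frac{U_{i-1}^{j+1}-2U_i^{j+1}+U_{i+1}^{j+1}}{(\triangle S)^2}+a e^{-V_i^j}e^{U_i^j}-b=0,\quad 1\le i\le I-1,\ 0\le j\le J-1,$$ $$\frac{V_i^{j+1}-V_i^j}{\triangle\tau}+c\,e^{-U_i^j}e^{V_i^j}-c=0,\quad 0\le i\le I,\ 0\le j\le J-1,$$ $$U_i^0=V_i^0=\gamma h(S_i)\ (0\le i\le I),\qquad U_0^j=\varphi_l(\tau_j),\quad U_I^j=\varphi_r(\tau_j)\ (0\le j\le J).$$ Then for sufficiently small $\triangle S$ and $\triangle\tau$ the error estimate $$\max_{0\le i\le I,\,0\le j\le J}|u(\tau_j,S_i)-U_i^j|+\max_{0\le i\le I,\,0\le j\le J}|v(\tau_j,S_i)-V_i^j|\le C\left(\triangle\tau+(\triangle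 S)^2\right)$$ holds, where the constant $C$ does not depend on $\triangle S$ and $\triangle\tau$. (That is, there exist $C,\delta>0$ such that the estimate holds for every mesh with $\triangle S\le\delta$ and $\triangle\tau\le\delta$.)
   Context: Constants: $\sigma,\gamma,T,S_{\max}>0$; $a=\nu_{01}>0$, $c=\nu_{10}>0$, $b=d_0+\nu_{01}$ with $d_0=\mu^2/(2\sigma^2)\ge0$, $\mu$ real. $h$ is a given function on $[0,S_{\max}]$ (the option payoff), and $\varphi_l,\varphi_r$ are given functions on $[0,T]$ (the boundary data). Uniform mesh: $S_i=i\triangle S$, $i=0,\dots,I$, with $I\triangle S=S_{\max}$, and $\tau_j=j\triangle\tau$, $j=0,\dots,J$, with $J\triangle\tau=T$ ($I\ge2$, $J\ge1$ integers). $C^{2,4}(Q_T)$ is the space of functions $w(\tau,S)$ on $Q_T$ such that all partial derivatives $\partial_S^i\partial_\tau^j w$ with $i+2j\le4$ exist and are continuous on $Q_T$. *)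

(* Defs.v *)
From Stdlib Require Import Reals.
From Coquelicot Require Import Coquelicot.

Open Scope R_scope.

(** Functions on [Q_T] are represented by total functions [w : R -> R -> R] of
    [(tau, s)], in this order; only their values on [Q T Smax] ever matter. *)
Definition Q (T Smax : R) (p : R * R) : Prop :=
  0 <= fst p <= T /\ 0 <= snd p <= Smax.

(** [D_in] is the derivative relative to a subset, so the partial derivatives
    are one-sided on the edges of the closed rectangle. *)
Definition is_dtau (T Smax : R) (w w' : R -> R -> R) : Prop :=
  forall tau s, Q T Smax (tau, s) ->
    D_in (fun t => w t s) (fun t => w' t s) (fun t => 0 <= t <= T) tau.

Definition is_ds (T Smax : R) (w w' : R -> R -> R) : Prop :=
  forall tau s, Q T Smax (tau, s) ->
    D_in (w tau) (w' tau) (fun x => 0 <= x <= Smax) s.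

(** [D i j] stands for the partial derivative of order [j] in [tau] followed by
    order [i] in [s]. *)
Definition C24 (T Smax : R) (w : R -> R -> R) : Prop :=
  exists D : nat -> nat -> R -> R -> R,
    (forall tau s, Q T Smax (tau, s) -> D 0%nat 0%nat tau s = w tau s) /\
    (forall j, (2 * S j <= 4)%nat -> is_dtau T Smax (D 0%nat j) (D 0%nat (S j))) /\
    (forall i j, (S i + 2 * j <= 4)%nat -> is_ds T Smax (D i j) (D (S i) j)) /\
    (forall i j, (i + 2 * j <= 4)%nat ->
       continuous_on (Q T Smax) (fun p : R * R => D i j (fst p) (snd p))).

Definition classical_solution (sigma gamma T Smax a b c : R)
    (h phil phir : R -> R) (u v : R -> R -> R) : Prop :=
  (exists u_tau u_s u_ss v_tau : R -> R -> R,
     is_dtau T Smax u u_tau /\ is_ds T Smax u u_s /\ is_ds T Smax u_s u_ss /\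
     is_dtau T Smax v v_tau /\
     forall tau s, Q T Smax (tau, s) ->
       u_tau tau s - 1 / 2 * sigma ^ 2 * s ^ 2 * u_ss tau s
         + a * exp (u tau s) * exp (- v tau s) - b = 0 /\
       v_tau tau s + c * exp (v tau s) * exp (- u tau s) - c = 0) /\
  (forall s, 0 <= s <= Smax -> u 0 s = gamma * h s /\ v 0 s = gamma * h s) /\
  (forall tau, 0 <= tau <= T -> u tau 0 = phil tau /\ u tau Smax = phir tau).

(** [U i j] is the value at the node [(tau_j, S_i) = (j * dtau, i * ds)]; values
    with [i > nI] or [j > nJ] are irrelevant. *)
Definition imex_scheme (sigma gamma a b c : R) (h phil phir : R -> R)
    (nI nJ : nat) (ds dtau : R) (U V : nat -> nat -> R) : Prop :=
  (forall i j, (1 <= i <= nI - 1)%nat -> (j <= nJ - 1)%nat ->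
     (U i (S j) - U i j) / dtau
       - 1 / 2 * sigma ^ 2 * (INR i * ds) ^ 2
         * ((U (i - 1)%nat (S j) - 2 * U i (S j) + U (S i) (S j)) / ds ^ 2)
       + a * exp (- V i j) * exp (U i j) - b = 0) /\
  (forall i j, (i <= nI)%nat -> (j <= nJ - 1)%nat ->
     (V i (S j) - V i j) / dtau + c * exp (- U i j) * exp (V i j) - c = 0) /\
  (forall i, (i <= nI)%nat ->
     U i 0%nat = gamma * h (INR i * ds) /\ V i 0%nat = gamma * h (INR i * ds)) /\
  (forall j, (j <= nJ)%nat ->
     U 0%nat j = phil (INR j * dtau) /\ U nI j = phir (INR j * dtau)).

(** Maximum of [f 0, ..., f n], both ends included. *)
Fixpoint max_upto (f : nat -> R) (n : nat) : R :=
  match n with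
  | O => f O
  | S m => Rmax (max_upto f m) (f (S m))
  end.

Definition grid_error (nI nJ : nat) (ds dtau : R)
    (w : R -> R -> R) (W : nat -> nat -> R) : R :=
  max_upto (fun i =>
    max_upto (fun j => Rabs (w (INR j * dtau) (INR i * ds) - W i j)) nJ) nI.

(* Main.v *)
(** The exact solution satisfies the scheme up to a truncation error
    [O(dtau + ds^2)], by Taylor expansion on the closed rectangle. For the error,
    the implicit diffusion step does not increase the maximum norm (discrete
    maximum principle), while the explicit reaction term multiplies it by at most
    [1 + Lam * dtau] as long as the error is at most [1/2], since [exp] is only
    locally Lipschitz. This smallness is propagated together with the Gronwall
    bound [K0 * (dtau + ds^2) * t * exp (Lam * t)], which stays below [1/2] on
    [[0, T]] once the mesh is fine enough. *)

Require Import Defs.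
From Stdlib Require Import Reals Lra Lia ClassicalEpsilon.
From Coquelicot Require Import Coquelicot.

Open Scope R_scope.

(** * One-sided calculus on a closed interval *)

(** Retraction of the line onto [[l, r]]: composing with it extends a function on the interval to a
    continuous one on the whole line, the form in which the mean value theorem applies. *)
Definition clamp (l r x : R) : R := Rmax l (Rmin r x).

Lemma clamp_in l r x : l <= r -> l <= clamp l r x <= r.
Proof.
  intros H; unfold clamp.
  split; [apply Rmax_l | apply Rmax_lub; [exact H | apply Rmin_l]].
Qed.

Lemma clamp_id l r x : l <= x <= r -> clamp l r x = x.
Proof. intros H; unfold clamp; rewrite Rmin_right, Rmax_right; lra. Qed.

Lemma clamp_lipschitz l r x y :
  Rabs (clamp l r x - clamp l r y) <= Rabs (x - y).
Proof.
  unfold clamp, Rmax, Rmin.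
  repeat destruct Rle_dec; unfold Rabs; repeat destruct Rcase_abs; lra.
Qed.

Section IntervalCalculus.

Variables (l r : R) (f f' : R -> R).
Let I (x : R) : Prop := l <= x <= r.
Hypothesis Df : forall x, I x -> D_in f f' I x.

Lemma clamp_continuity x : l <= r -> continuity_pt (fun t => f (clamp l r t)) x.
Proof.
  intros Hlr eps Heps.
  pose proof (clamp_in l r x Hlr) as Hx.
  destruct (cont_deriv f f' I _ (Df _ Hx) eps Heps) as [alp [Halp H]].
  exists alp; split; [exact Halp|].
  intros y [_ Hy]; cbn in Hy |- *; unfold Rdist in *.
  (* Relative continuity says nothing about the base point itself, so the case where both points
     clamp to the same value is separate. *)
  destruct (Req_dec (clamp l r x) (clamp l r y)) as [E|E].
  - rewrite E, Rminus_diag, Rabs_R0; exact Heps.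
  - apply H; split.
    + split; [apply clamp_in; exact Hlr | exact E].
    + cbn; unfold Rdist; eapply Rle_lt_trans; [apply clamp_lipschitz | exact Hy].
Qed.

(** Near an interior point small increments stay in the interval, where [clamp] is the identity. At
    an endpoint the extension may have a kink. *)
Lemma clamp_derive x : l < x < r -> is_derive (fun t => f (clamp l r t)) x (f' x).
Proof.
  intros Hx; apply is_derive_Reals; intros eps Heps.
  assert (Hx' : I x) by (unfold I; lra).
  destruct (Df x Hx' eps Heps) as [alp [Halp H]].
  assert (Hd : 0 < Rmin alp (Rmin (x - l) (r - x)))
    by (repeat apply Rmin_glb_lt; lra).
  exists (mkposreal _ Hd); intros d Hd0 Hdl; cbn in Hdl.
  assert (H1 : Rabs d < alp) by (eapply Rlt_le_trans; [exact Hdl | apply Rmin_l]).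
  assert (H2 : Rabs d < x - l) by
    (eapply Rlt_le_trans; [exact Hdl |]; eapply Rle_trans; [apply Rmin_r | apply Rmin_l]).
  assert (H3 : Rabs d < r - x) by
    (eapply Rlt_le_trans; [exact Hdl |]; eapply Rle_trans; [apply Rmin_r | apply Rmin_r]).
  apply Rabs_def2 in H2; apply Rabs_def2 in H3.
  rewrite !clamp_id by lra.
  specialize (H (x + d)); cbn in H; unfold Rdist in H.
  replace (x + d - x) with d in H by ring.
  apply H; repeat split; unfold I; lra.
Qed.

(** One integration of a remainder bound, done by the mean value theorem: it raises the order by one
    and keeps [M], giving up the factor [1 / (n + 1)]. *)
Lemma taylor_step (p p' : R -> R) (x M : R) (n : nat) :
  (forall y, is_derive p y (p' y)) ->
  I x -> 0 <= M -> f x = p x ->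
  (forall y, I y -> Rabs (f' y - p' y) <= M * Rabs (y - x) ^ n) ->
  forall y, I y -> Rabs (f y - p y) <= M * Rabs (y - x) ^ S n.
Proof.
  intros Dp Hx HM Hfp Hbd y Hy; unfold I in Hx, Hy.
  destruct (MVT_gen (fun t => f (clamp l r t) - p t) x y (fun t => f' t - p' t))
    as [c [Hc E]].
  - intros t Ht; apply (is_derive_minus (fun t => f (clamp l r t)) p); [|apply Dp].
    apply clamp_derive.
    unfold Rmin, Rmax in Ht; destruct Rle_dec; lra.
  - intros t Ht; apply continuity_pt_minus.
    + apply clamp_continuity; lra.
    + apply derivable_continuous_pt; exists (p' t); apply is_derive_Reals, Dp.
  - rewrite !clamp_id in E by lra.
    replace (f y - p y) with ((f' c - p' c) * (y - x)) by lra.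
    rewrite Rabs_mult; cbn [pow].
    assert (Hcx : Rabs (c - x) <= Rabs (y - x)).
    { unfold Rmin, Rmax in Hc; destruct Rle_dec;
        unfold Rabs; repeat destruct Rcase_abs; lra. }
    assert (Hcl : I c)
      by (unfold I; unfold Rmin, Rmax in Hc; destruct Rle_dec; lra).
    apply Rle_trans with (M * Rabs (c - x) ^ n * Rabs (y - x)).
    + apply Rmult_le_compat_r; [apply Rabs_pos | apply Hbd, Hcl].
    + rewrite (Rmult_comm (Rabs (y - x))), <- Rmult_assoc.
      apply Rmult_le_compat_r; [apply Rabs_pos |].
      apply Rmult_le_compat_l; [exact HM |].
      apply pow_incr; split; [apply Rabs_pos | exact Hcx].
Qed.

End IntervalCalculus.

(** Every point of a nondegenerate interval is an accumulation point of it, so the limit is unique.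
    This identifies the derivatives in the equation with those supplied by [C24]. *)
Lemma D_in_unique (l r : R) (f g f' g' : R -> R) (x : R) :
  l < r -> l <= x <= r -> (forall y, l <= y <= r -> f y = g y) ->
  D_in f f' (fun y => l <= y <= r) x -> D_in g g' (fun y => l <= y <= r) x ->
  f' x = g' x.
Proof.
  intros Hlr Hx Hfg Hf Hg.
  eapply single_limit; [| exact Hf |].
  - intros alp Halp.
    (* Move by [alp / 2] to the right or to the left; if neither stays inside, both endpoints are
       within [alp / 2] of [x], and one of them differs from [x]. *)
    destruct (Rle_dec (x + alp / 2) r).
    + exists (x + alp / 2); repeat split; try lra.
      unfold Rdist; rewrite Rabs_pos_eq; lra.
    + destruct (Rle_dec l (x - alp / 2)).
      * exists (x - alp / 2); repeat split; try lra.
        unfold Rdist; rewrite Rabs_left; lra.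
      * destruct (Req_dec x l).
        -- exists r; repeat split; try lra.
           unfold Rdist; rewrite Rabs_pos_eq; lra.
        -- exists l; repeat split; try lra.
           unfold Rdist; rewrite Rabs_left; lra.
  - intros eps Heps; destruct (Hg eps Heps) as [alp [Halp H]].
    exists alp; split; [exact Halp|].
    intros y Hy; rewrite (Hfg x Hx), (Hfg y) by apply Hy; apply H, Hy.
Qed.

(** One [taylor_step] per order, comparing each derivative of [f] with that of the Taylor
    polynomial, down to the bounded one. The lost factorials only affect constants. *)
Lemma taylor1 (l r : R) (f f1 f2 : R -> R) (M x y : R) :
  let I := fun t => l <= t <= r in
  (forall t, I t -> D_in f f1 I t) -> (forall t, I t -> D_in f1 f2 I t) ->
  (forall t, I t -> Rabs (f2 t) <= M) -> I x -> I y ->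
  Rabs (f y - f x - f1 x * (y - x)) <= M * (y - x) ^ 2.
Proof.
  intros I D0 D1 HM Hx Hy.
  assert (M0 : 0 <= M) by (eapply Rle_trans; [apply Rabs_pos | apply (HM x Hx)]).
  rewrite <- pow2_abs.
  replace (f y - f x - f1 x * (y - x)) with (f y - (f x + f1 x * (y - x))) by ring.
  apply (taylor_step l r f f1 D0 (fun t => f x + f1 x * (t - x)) (fun t => f1 x) x M 1);
    trivial; try ring; [intros t; auto_derive; trivial; ring |].
  apply (taylor_step l r f1 f2 D1 (fun t => f1 x) (fun t => 0) x M 0); trivial;
    [intros t; auto_derive; trivial; ring |].
  intros t Ht; rewrite Rminus_0_r; cbn; rewrite Rmult_1_r; auto.
Qed.

Lemma lipschitz_of_derivative (l r : R) (f f1 : R -> R) (M x y : R) :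
  let I := fun t => l <= t <= r in
  (forall t, I t -> D_in f f1 I t) ->
  (forall t, I t -> Rabs (f1 t) <= M) -> I x -> I y ->
  Rabs (f y - f x) <= M * Rabs (y - x).
Proof.
  intros I D0 HM Hx Hy.
  assert (M0 : 0 <= M) by (eapply Rle_trans; [apply Rabs_pos | apply (HM x Hx)]).
  rewrite <- (pow_1 (Rabs (y - x))).
  apply (taylor_step l r f f1 D0 (fun t => f x) (fun t => 0) x M 0); trivial;
    [intros t; auto_derive; trivial; ring |].
  intros t Ht; rewrite Rminus_0_r; cbn; rewrite Rmult_1_r; auto.
Qed.

Lemma taylor3 (l r : R) (f f1 f2 f3 f4 : R -> R) (M x y : R) :
  let I := fun t => l <= t <= r in
  (forall t, I t -> D_in f f1 I t) -> (forall t, I t -> D_in f1 f2 I t) ->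
  (forall t, I t -> D_in f2 f3 I t) -> (forall t, I t -> D_in f3 f4 I t) ->
  (forall t, I t -> Rabs (f4 t) <= M) -> I x -> I y ->
  Rabs (f y - (f x + f1 x * (y - x) + f2 x * (y - x) ^ 2 / 2 + f3 x * (y - x) ^ 3 / 6))
    <= M * (y - x) ^ 4.
Proof.
  intros I D0 D1 D2 D3 HM Hx Hy.
  assert (M0 : 0 <= M) by (eapply Rle_trans; [apply Rabs_pos | apply (HM x Hx)]).
  replace ((y - x) ^ 4) with (Rabs (y - x) ^ 4)
    by (rewrite RPow_abs; apply Rabs_pos_eq; pose proof (pow2_ge_0 ((y - x) ^ 2)); lra).
  apply (taylor_step l r f f1 D0
    (fun t => f x + f1 x * (t - x) + f2 x * (t - x) ^ 2 / 2 + f3 x * (t - x) ^ 3 / 6)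
    (fun t => f1 x + f2 x * (t - x) + f3 x * (t - x) ^ 2 / 2) x M 3); trivial;
    [intros t; auto_derive; trivial; field | field |].
  apply (taylor_step l r f1 f2 D1
    (fun t => f1 x + f2 x * (t - x) + f3 x * (t - x) ^ 2 / 2)
    (fun t => f2 x + f3 x * (t - x)) x M 2); trivial;
    [intros t; auto_derive; trivial; field | field |].
  apply (taylor_step l r f2 f3 D2
    (fun t => f2 x + f3 x * (t - x)) (fun t => f3 x) x M 1); trivial;
    [intros t; auto_derive; trivial; ring | ring |].
  apply (taylor_step l r f3 f4 D3 (fun t => f3 x) (fun t => 0) x M 0); trivial;
    [intros t; auto_derive; trivial; ring |].
  intros t Ht; rewrite Rminus_0_r; cbn; rewrite Rmult_1_r; auto.
Qed.

(* The cubic Taylor terms at [x - d] and [x + d] cancel. *)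
Lemma central_second_difference (l r : R) (f f1 f2 f3 f4 : R -> R) (M x d : R) :
  let I := fun t => l <= t <= r in
  (forall t, I t -> D_in f f1 I t) -> (forall t, I t -> D_in f1 f2 I t) ->
  (forall t, I t -> D_in f2 f3 I t) -> (forall t, I t -> D_in f3 f4 I t) ->
  (forall t, I t -> Rabs (f4 t) <= M) -> 0 < d -> I (x - d) -> I (x + d) ->
  Rabs ((f (x - d) - 2 * f x + f (x + d)) / d ^ 2 - f2 x) <= 2 * M * d ^ 2.
Proof.
  intros I D0 D1 D2 D3 HM Hd Hl Hr.
  assert (Hx : I x) by (unfold I in *; lra).
  pose proof (taylor3 l r f f1 f2 f3 f4 M x (x - d) D0 D1 D2 D3 HM Hx Hl) as TL.
  pose proof (taylor3 l r f f1 f2 f3 f4 M x (x + d) D0 D1 D2 D3 HM Hx Hr) as TR.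
  replace (x - d - x) with (- d) in TL by ring.
  replace (x + d - x) with d in TR by ring.
  apply Rabs_le_between in TL; apply Rabs_le_between in TR.
  assert (Hd2 : 0 < d ^ 2) by (apply pow_lt; exact Hd).
  replace ((f (x - d) - 2 * f x + f (x + d)) / d ^ 2 - f2 x)
    with ((f (x - d) - 2 * f x + f (x + d) - d ^ 2 * f2 x) / d ^ 2) by (field; lra).
  rewrite Rabs_div, (Rabs_pos_eq (d ^ 2)) by lra.
  apply Rle_div_l; [exact Hd2 |].
  apply Rabs_le_between; lra.
Qed.

(** * Uniform bounds on the rectangle for [C24] functions *)

(* The radius function of the compactness argument also encodes the size of
   [|w|]: a positive lower bound on it yields an upper bound on [|w|]. *)
Lemma continuous_on_rectangle_bounded (T Smax : R) (w : R -> R -> R) :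
  continuous_on (Q T Smax) (fun p : R * R => w (fst p) (snd p)) ->
  exists M, 0 <= M /\ forall t s, Q T Smax (t, s) -> Rabs (w t s) <= M.
Proof.
  intros Hw.
  assert (Hr : forall t s, exists d : posreal, d <= / (1 + Rabs (w t s)) /\
     (Q T Smax (t, s) -> forall t' s', Q T Smax (t', s') ->
       Rabs (t' - t) < d -> Rabs (s' - s) < d -> Rabs (w t' s' - w t s) < 1)).
  { intros t s.
    assert (Hp : 0 < / (1 + Rabs (w t s)))
      by (apply Rinv_0_lt_compat; pose proof (Rabs_pos (w t s)); lra).
    destruct (classic (Q T Smax (t, s))) as [Hq | Hq].
    - pose proof (Hw (t, s) Hq) as L.
      destruct (proj1 (filterlim_locally _ _) L (mkposreal 1 Rlt_0_1)) as [e He].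
      exists (mkposreal _ (Rmin_stable_in_posreal e (mkposreal _ Hp))); cbn.
      split; [apply Rmin_r |].
      intros _ t' s' Hq' H1 H2.
      refine (He (t', s') _ Hq'); split; cbn.
      + eapply Rlt_le_trans; [exact H1 | apply Rmin_l].
      + eapply Rlt_le_trans; [exact H2 | apply Rmin_l].
    - exists (mkposreal _ Hp); split; [apply Rle_refl | tauto]. }
  (* The compactness lemma takes the radius as a function of the point, hence the choice. *)
  set (delta := fun t s => proj1_sig (constructive_indefinite_description _ (Hr t s))).
  destruct (compactness_value_2d 0 T 0 Smax delta) as [d Hd].
  exists (/ d + 1); split.
  { pose proof (Rinv_0_lt_compat d (cond_pos d)); lra. }
  intros t s [Ht Hs]; cbn in Ht, Hs.
  (* Compactness yields a nearby centre of radius at least [d] only under a double negation, so the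
     bound is proved by contradiction. *)
  apply NNPP; intros Hn; apply (Hd t s Ht Hs); intros [t0 [s0 [Ht0 [Hs0 [H1 [H2 H3]]]]]].
  apply Hn.
  destruct (proj2_sig (constructive_indefinite_description _ (Hr t0 s0))) as [Ha Hb].
  fold (delta t0 s0) in Ha, Hb.
  pose proof (Hb (conj Ht0 Hs0) t s (conj Ht Hs) H1 H2) as H4.
  assert (H5 : 1 + Rabs (w t0 s0) <= / d).
  { rewrite <- (Rinv_inv (1 + Rabs (w t0 s0))).
    apply Rinv_le_contravar; [apply cond_pos | lra]. }
  pose proof (Rabs_triang_inv (w t s) (w t0 s0)); lra.
Qed.

Lemma C24_bounded (T Smax : R) (w : R -> R -> R) :
  C24 T Smax w ->
  exists M, 0 <= M /\ forall t s, Q T Smax (t, s) -> Rabs (w t s) <= M.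
Proof.
  intros [D [H0 [_ [_ Hc]]]].
  destruct (continuous_on_rectangle_bounded T Smax (D 0%nat 0%nat)) as [M [M0 HM]].
  { apply Hc; lia. }
  exists M; split; [exact M0 |].
  intros t s Hq; rewrite <- H0 by exact Hq; apply HM, Hq.
Qed.

Lemma C24_lipschitz_tau (T Smax : R) (w : R -> R -> R) :
  C24 T Smax w ->
  exists M, 0 <= M /\ forall t t' s, Q T Smax (t, s) -> Q T Smax (t', s) ->
    Rabs (w t' s - w t s) <= M * Rabs (t' - t).
Proof.
  intros [D [H0 [Ht [_ Hc]]]].
  destruct (continuous_on_rectangle_bounded T Smax (D 0%nat 1%nat)) as [M [M0 HM]].
  { apply Hc; lia. }
  exists M; split; [exact M0 |].
  intros t t' s Hq Hq'; rewrite <- !H0 by assumption.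
  destruct Hq as [Hqt Hqs], Hq' as [Hqt' _]; cbn in *.
  apply (lipschitz_of_derivative 0 T (fun t => D 0%nat 0%nat t s)
           (fun t => D 0%nat 1%nat t s) M t t'); try assumption.
  - intros y Hy; apply (Ht 0%nat); [lia | split; assumption].
  - intros y Hy; apply HM; split; assumption.
Qed.

Lemma C24_taylor_tau (T Smax : R) (w w_tau : R -> R -> R) :
  0 < T -> C24 T Smax w -> is_dtau T Smax w w_tau ->
  exists M, 0 <= M /\ forall t t' s, Q T Smax (t, s) -> Q T Smax (t', s) ->
    Rabs (w t' s - w t s - w_tau t s * (t' - t)) <= M * (t' - t) ^ 2.
Proof.
  intros HT [D [H0 [Ht [_ Hc]]]] Hw.
  destruct (continuous_on_rectangle_bounded T Smax (D 0%nat 2%nat)) as [M [M0 HM]].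
  { apply Hc; lia. }
  exists M; split; [exact M0 |].
  intros t t' s Hq Hq'.
  assert (E : w_tau t s = D 0%nat 1%nat t s).
  { apply (D_in_unique 0 T (fun t => w t s) (fun t => D 0%nat 0%nat t s)
             (fun t => w_tau t s) (fun t => D 0%nat 1%nat t s) t HT); try apply Hq.
    - intros y Hy; symmetry; apply H0; split; [exact Hy | apply Hq].
    - apply Hw, Hq.
    - apply (Ht 0%nat); [lia | exact Hq]. }
  rewrite E, <- !H0 by assumption.
  destruct Hq as [Hqt Hqs], Hq' as [Hqt' _]; cbn in *.
  apply (taylor1 0 T (fun t => D 0%nat 0%nat t s) (fun t => D 0%nat 1%nat t s)
           (fun t => D 0%nat 2%nat t s) M t t'); try assumption.
  - intros y Hy; apply (Ht 0%nat); [lia | split; assumption].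
  - intros y Hy; apply (Ht 1%nat); [lia | split; assumption].
  - intros y Hy; apply HM; split; assumption.
Qed.

Lemma C24_second_difference (T Smax : R) (w w_s w_ss : R -> R -> R) :
  0 < Smax -> C24 T Smax w -> is_ds T Smax w w_s -> is_ds T Smax w_s w_ss ->
  exists M, 0 <= M /\ forall t s d, 0 < d ->
    Q T Smax (t, s - d) -> Q T Smax (t, s + d) ->
    Rabs ((w t (s - d) - 2 * w t s + w t (s + d)) / d ^ 2 - w_ss t s) <= M * d ^ 2.
Proof.
  intros HS [D [H0 [_ [Hs Hc]]]] Hw1 Hw2.
  destruct (continuous_on_rectangle_bounded T Smax (D 4%nat 0%nat)) as [M [M0 HM]].
  { apply Hc; lia. }
  exists (2 * M); split; [lra |].
  intros t s d Hd Hl Hr.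
  assert (Ht : 0 <= t <= T) by apply Hl.
  (* The first derivatives must agree on the whole segment, since the second ones are then compared
     as derivatives of these functions. *)
  assert (E1 : forall y, 0 <= y <= Smax -> w_s t y = D 1%nat 0%nat t y).
  { intros y Hy.
    apply (D_in_unique 0 Smax (w t) (D 0%nat 0%nat t) (w_s t) (D 1%nat 0%nat t) y HS);
      try assumption.
    - intros x Hx; symmetry; apply H0; split; assumption.
    - apply Hw1; split; assumption.
    - apply (Hs 0%nat 0%nat); [lia | split; assumption]. }
  destruct Hl as [_ Hl], Hr as [_ Hr]; cbn in Hl, Hr.
  assert (E2 : w_ss t s = D 2%nat 0%nat t s).
  { apply (D_in_unique 0 Smax (w_s t) (D 1%nat 0%nat t) (w_ss t) (D 2%nat 0%nat t) s HS);
      try assumption; [lra | |].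
    - apply Hw2; split; cbn; lra.
    - apply (Hs 1%nat 0%nat); [lia | split; cbn; lra]. }
  rewrite E2, <- !H0 by (split; cbn; lra).
  apply (central_second_difference 0 Smax (D 0%nat 0%nat t) (D 1%nat 0%nat t)
    (D 2%nat 0%nat t) (D 3%nat 0%nat t) (D 4%nat 0%nat t) M s d); try assumption;
    intros y Hy.
  1-4: apply Hs; [lia | split; assumption].
  apply HM; split; assumption.
Qed.

(** * Estimates for the exponential *)

Lemma exp_le_exp (x y : R) : x <= y -> exp x <= exp y.
Proof.
  intros [H | H]; [apply Rlt_le, exp_increasing, H | rewrite H; apply Rle_refl].
Qed.

Lemma exp_lipschitz (M x y : R) :
  x <= M -> y <= M -> Rabs (exp x - exp y) <= exp M * Rabs (x - y).
Proof.
  intros Hx Hy.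
  destruct (MVT_gen exp y x exp) as [z [Hz E]].
  - intros t _; apply is_derive_Reals, derivable_pt_lim_exp.
  - intros t _; apply derivable_continuous_pt, derivable_pt_exp.
  - rewrite E, Rabs_mult, Rabs_pos_eq by (apply Rlt_le, exp_pos).
    apply Rmult_le_compat_r; [apply Rabs_pos |].
    apply exp_le_exp.
    unfold Rmax in Hz; destruct Rle_dec; lra.
Qed.

(** * Truncation error of the scheme *)

Section Consistency.

Variables (sigma T Smax a b c : R) (u v : R -> R -> R).
Hypotheses (hT : 0 < T) (hSmax : 0 < Smax) (ha : 0 < a).
Hypotheses (Cu : C24 T Smax u) (Cv : C24 T Smax v).

(* The scheme takes the spatial term at the new time level, so the equation is
   used at [t + k], and the reaction term is shifted back to [t] by Lipschitz
   continuity in time. *)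
Lemma u_consistency (u_tau u_s u_ss : R -> R -> R) :
  is_dtau T Smax u u_tau -> is_ds T Smax u u_s -> is_ds T Smax u_s u_ss ->
  (forall t s, Q T Smax (t, s) ->
     u_tau t s - 1 / 2 * sigma ^ 2 * s ^ 2 * u_ss t s
       + a * exp (u t s) * exp (- v t s) - b = 0) ->
  exists K, 0 <= K /\ forall t s k d, 0 < k -> 0 < d ->
    0 <= t -> t + k <= T -> 0 <= s - d -> s + d <= Smax ->
    Rabs ((u (t + k) s - u t s) / k
      - 1 / 2 * sigma ^ 2 * s ^ 2
        * ((u (t + k) (s - d) - 2 * u (t + k) s + u (t + k) (s + d)) / d ^ 2)
      + a * exp (u t s - v t s) - b) <= K * (k + d ^ 2).
Proof.
  intros Dt Ds Dss Eq.
  destruct (C24_bounded _ _ _ Cu) as [Mu [Mu0 HMu]].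
  destruct (C24_bounded _ _ _ Cv) as [Mv [Mv0 HMv]].
  destruct (C24_lipschitz_tau _ _ _ Cu) as [Lu [Lu0 HLu]].
  destruct (C24_lipschitz_tau _ _ _ Cv) as [Lv [Lv0 HLv]].
  destruct (C24_taylor_tau _ _ _ _ hT Cu Dt) as [Mt [Mt0 HMt]].
  destruct (C24_second_difference _ _ _ _ _ hSmax Cu Ds Dss) as [Ms [Ms0 HMs]].
  set (L := exp (Mu + Mv)).
  assert (HL : 0 < L) by apply exp_pos.
  (* [A] bounds the diffusion coefficient times the constant of the second difference; [B] below
     bounds the change of the reaction term over one time step, per unit of time. *)
  set (A := 1 / 2 * sigma ^ 2 * Smax ^ 2 * Ms).
  assert (HA : 0 <= A).
  { apply Rmult_le_pos; [| exact Ms0].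
    pose proof (pow2_ge_0 sigma); pose proof (pow2_ge_0 Smax); nra. }
  set (B := a * (L * (Lu + Lv))).
  assert (HB : 0 <= B) by (unfold B; apply Rmult_le_pos; nra).
  exists (Mt + A + B); split; [lra |].
  intros t s k d Hk Hd Ht Htk Hl Hr.
  assert (Q0 : Q T Smax (t, s)) by (split; cbn; lra).
  assert (Q1 : Q T Smax (t + k, s)) by (split; cbn; lra).
  assert (Ql : Q T Smax (t + k, s - d)) by (split; cbn; lra).
  assert (Qr : Q T Smax (t + k, s + d)) by (split; cbn; lra).
  pose proof (Eq _ _ Q1) as E.
  rewrite (Rmult_assoc a), <- exp_plus in E.
  change (u (t + k) s + - v (t + k) s) with (u (t + k) s - v (t + k) s) in E.
  assert (B1 : Rabs ((u (t + k) s - u t s) / k - u_tau (t + k) s) <= Mt * k).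
  { pose proof (HMt (t + k) t s Q1 Q0) as H.
    replace ((u (t + k) s - u t s) / k - u_tau (t + k) s)
      with (- (u t s - u (t + k) s - u_tau (t + k) s * (t - (t + k))) / k)
      by (field; lra).
    rewrite Rabs_div, Rabs_Ropp, (Rabs_pos_eq k) by lra.
    apply Rle_div_l; [exact Hk |].
    replace (Mt * k * k) with (Mt * (t - (t + k)) ^ 2) by ring; exact H. }
  assert (B2 : Rabs (1 / 2 * sigma ^ 2 * s ^ 2 *
    ((u (t + k) (s - d) - 2 * u (t + k) s + u (t + k) (s + d)) / d ^ 2
      - u_ss (t + k) s)) <= A * d ^ 2).
  { pose proof (HMs (t + k) s d Hd Ql Qr) as H.
    assert (Hs2 : s ^ 2 <= Smax ^ 2) by (apply pow_incr; lra).
    pose proof (pow2_ge_0 sigma) as Hsig; pose proof (pow2_ge_0 s).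
    rewrite Rabs_mult, Rabs_pos_eq by nra.
    unfold A; rewrite (Rmult_assoc _ Ms).
    apply Rmult_le_compat; [nra | apply Rabs_pos | nra | exact H]. }
  assert (B3 : Rabs (a * (exp (u t s - v t s) - exp (u (t + k) s - v (t + k) s)))
                 <= B * k).
  { rewrite Rabs_mult, (Rabs_pos_eq a) by lra.
    unfold B; rewrite Rmult_assoc.
    apply Rmult_le_compat_l; [lra |].
    pose proof (HMu _ _ Q0) as H1; pose proof (HMv _ _ Q0) as H2.
    pose proof (HMu _ _ Q1) as H3; pose proof (HMv _ _ Q1) as H4.
    apply Rabs_le_between in H1; apply Rabs_le_between in H2.
    apply Rabs_le_between in H3; apply Rabs_le_between in H4.
    eapply Rle_trans; [apply (exp_lipschitz (Mu + Mv)); lra |].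
    fold L; rewrite Rmult_assoc; apply Rmult_le_compat_l; [lra |].
    pose proof (HLu _ _ _ Q1 Q0) as H5; pose proof (HLv _ _ _ Q1 Q0) as H6.
    replace (t - (t + k)) with (- k) in H5, H6 by ring.
    rewrite Rabs_Ropp, (Rabs_pos_eq k) in H5, H6 by lra.
    apply Rabs_le_between in H5; apply Rabs_le_between in H6.
    apply Rabs_le_between; lra. }
  (* By [E], the truncation error is the quantity of [B1], minus that of [B2], plus that of [B3]. *)
  apply Rabs_le_between in B1; apply Rabs_le_between in B2.
  apply Rabs_le_between in B3.
  pose proof (pow2_ge_0 d).
  apply Rabs_le_between; nra.
Qed.

(** With no spatial derivative, the equation can be used at the old level [t]: a forward Taylor
    expansion leaves an error of order [k], also at boundary nodes. *)
Lemma v_consistency (v_tau : R -> R -> R) :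
  is_dtau T Smax v v_tau ->
  (forall t s, Q T Smax (t, s) ->
     v_tau t s + c * exp (v t s) * exp (- u t s) - c = 0) ->
  exists K, 0 <= K /\ forall t s k, 0 < k ->
    0 <= t -> t + k <= T -> 0 <= s <= Smax ->
    Rabs ((v (t + k) s - v t s) / k + c * exp (v t s - u t s) - c) <= K * k.
Proof.
  intros Dt Eq.
  destruct (C24_taylor_tau _ _ _ _ hT Cv Dt) as [M [M0 HM]].
  exists M; split; [exact M0 |].
  intros t s k Hk Ht Htk Hs.
  assert (Q0 : Q T Smax (t, s)) by (split; cbn; lra).
  assert (Q1 : Q T Smax (t + k, s)) by (split; cbn; lra).
  pose proof (Eq _ _ Q0) as E.
  rewrite Rmult_assoc, <- exp_plus in E.
  change (v t s + - u t s) with (v t s - u t s) in E.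
  replace ((v (t + k) s - v t s) / k + c * exp (v t s - u t s) - c)
    with ((v (t + k) s - v t s) / k - v_tau t s) by lra.
  replace ((v (t + k) s - v t s) / k - v_tau t s)
    with ((v (t + k) s - v t s - v_tau t s * (t + k - t)) / k) by (field; lra).
  rewrite Rabs_div, (Rabs_pos_eq k) by lra.
  apply Rle_div_l; [exact Hk |].
  replace (M * k * k) with (M * (t + k - t) ^ 2) by ring; apply HM; assumption.
Qed.

End Consistency.

(** * Grid maxima and the discrete maximum principle *)

Lemma max_upto_le (f : nat -> R) (n : nat) (B : R) :
  (forall i, (i <= n)%nat -> f i <= B) -> max_upto f n <= B.
Proof.
  induction n as [|n IH]; intros H; cbn; [apply H; lia |].
  apply Rmax_lub; [apply IH; intros i Hi |]; apply H; lia.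
Qed.

Lemma argmax_upto (f : nat -> R) (n : nat) :
  exists k, (k <= n)%nat /\ forall i, (i <= n)%nat -> f i <= f k.
Proof.
  induction n as [|n [k [Hk H]]].
  - exists 0%nat; split; [lia |].
    intros i Hi; replace i with 0%nat by lia; apply Rle_refl.
  - destruct (Rle_dec (f k) (f (S n))) as [Hle | Hgt].
    + exists (S n); split; [lia |]; intros i Hi.
      destruct (Nat.eq_dec i (S n)) as [-> | Hne]; [apply Rle_refl |].
      eapply Rle_trans; [apply H; lia | exact Hle].
    + exists k; split; [lia |]; intros i Hi.
      destruct (Nat.eq_dec i (S n)) as [-> | Hne]; [lra | apply H; lia].
Qed.

Section DiscreteMaximumPrinciple.

Variables (n : nat) (lam : nat -> R) (B : R).
Hypotheses (lam_ge0 : forall i, 0 <= lam i) (B_ge0 : 0 <= B).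

(** At an interior index where [w] is largest the second difference is at most 0, so the implicit
    operator there is at least [w]. *)
Lemma discrete_max_upper (w : nat -> R) :
  w 0%nat <= B -> w n <= B ->
  (forall i, (1 <= i <= n - 1)%nat ->
     w i - lam i * (w (i - 1)%nat - 2 * w i + w (S i)) <= B) ->
  forall i, (i <= n)%nat -> w i <= B.
Proof.
  intros H0 Hn Hin i Hi.
  destruct (argmax_upto w n) as [k [Hk Hmax]].
  apply Rle_trans with (w k); [apply Hmax, Hi |].
  destruct (Nat.eq_dec k 0) as [-> |]; [exact H0 |].
  destruct (Nat.eq_dec k n) as [-> |]; [exact Hn |].
  assert (H := Hin k ltac:(lia)).
  assert (H1 := Hmax (k - 1)%nat ltac:(lia)).
  assert (H2 := Hmax (S k) ltac:(lia)).
  specialize (lam_ge0 k); nra.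
Qed.

Lemma discrete_max_principle (w r : nat -> R) :
  w 0%nat = 0 -> w n = 0 ->
  (forall i, (1 <= i <= n - 1)%nat ->
     w i - lam i * (w (i - 1)%nat - 2 * w i + w (S i)) = r i /\ Rabs (r i) <= B) ->
  forall i, (i <= n)%nat -> Rabs (w i) <= B.
Proof.
  intros H0 Hn Hin i Hi.
  assert (Hup : w i <= B).
  { apply (discrete_max_upper w); try lra; try assumption.
    intros m Hm; destruct (Hin m Hm) as [E Hr]; apply Rabs_le_between in Hr; lra. }
  assert (Hlo : - w i <= B).
  { apply (discrete_max_upper (fun i => - w i)); try lra; try assumption.
    intros m Hm; destruct (Hin m Hm) as [E Hr]; apply Rabs_le_between in Hr; lra. }
  apply Rabs_le_between; lra.
Qed.

End DiscreteMaximumPrinciple.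

(** * Error growth over one time step *)

(** The factor [1 + k * Lam] is absorbed by [exp (k * Lam)], and the new contribution [k * K] by the
    increment of the linear factor, since the exponential is at least 1. *)
Lemma gronwall_step (K Lam t k : R) :
  0 <= K -> 0 <= Lam -> 0 <= t -> 0 < k ->
  (1 + k * Lam) * (K * t * exp (Lam * t)) + k * K
    <= K * (t + k) * exp (Lam * (t + k)).
Proof.
  intros HK HL Ht Hk.
  assert (Kt : 0 <= K * t) by nra.
  assert (Kk : 0 <= k * K) by nra.
  assert (E : 1 + k * Lam <= exp (k * Lam)) by apply exp_ineq1_le.
  assert (E1 : 1 <= exp (Lam * (t + k))).
  { rewrite <- exp_0; apply exp_le_exp; nra. }
  replace (Lam * (t + k)) with (k * Lam + Lam * t) in * by ring.
  rewrite exp_plus in *.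
  pose proof (exp_pos (Lam * t)).
  assert (0 <= K * t * exp (Lam * t) * (exp (k * Lam) - (1 + k * Lam)))
    by (apply Rmult_le_pos; [apply Rmult_le_pos |]; lra).
  nra.
Qed.

(** Two errors of size [G] move the exponent by at most [2 * G <= 1], so both exponents stay below
    [M + 1]. *)
Lemma exp_local_lipschitz (M G p q x y : R) :
  2 * G <= 1 -> p - q <= M -> Rabs (p - x) <= G -> Rabs (q - y) <= G ->
  Rabs (exp (p - q) - exp (x - y)) <= 2 * exp (M + 1) * G.
Proof.
  intros HG HM Hp Hq.
  apply Rabs_le_between in Hp; apply Rabs_le_between in Hq.
  eapply Rle_trans; [apply (exp_lipschitz (M + 1)); lra |].
  rewrite (Rmult_comm 2), Rmult_assoc.
  apply Rmult_le_compat_l; [apply Rlt_le, exp_pos |].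
  apply Rabs_le_between; lra.
Qed.

Section ErrorPropagation.

Variables (sigma a b c d k : R) (n : nat).
Variables (M G rho : R).
Hypotheses (ha : 0 < a) (hc : 0 < c) (hd : 0 < d) (hk : 0 < k).
Hypotheses (hG0 : 0 <= G) (hG1 : 2 * G <= 1) (hrho : 0 <= rho).

(** Local Lipschitz constant of the exponential times [a + c], which dominates both reaction rates:
    one growth factor then serves both equations. *)
Let Lam := 2 * exp (M + 1) * (a + c).

(* [p, p', P, P'] are the exact and the computed solution of the first equation
   at the old (unprimed) and new (primed) time level, [q, q', Q, Q'] those of the
   second one. *)
Lemma u_error_step (p q p' P Q P' : nat -> R) :
  (forall i, (i <= n)%nat -> p i - q i <= M) ->
  (forall i, (i <= n)%nat -> Rabs (p i - P i) <= G /\ Rabs (q i - Q i) <= G) ->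
  p' 0%nat = P' 0%nat -> p' n = P' n ->
  (forall i, (1 <= i <= n - 1)%nat ->
     Rabs ((p' i - p i) / k - 1 / 2 * sigma ^ 2 * (INR i * d) ^ 2
         * ((p' (i - 1)%nat - 2 * p' i + p' (S i)) / d ^ 2)
       + a * exp (p i - q i) - b) <= rho) ->
  (forall i, (1 <= i <= n - 1)%nat ->
     (P' i - P i) / k - 1 / 2 * sigma ^ 2 * (INR i * d) ^ 2
         * ((P' (i - 1)%nat - 2 * P' i + P' (S i)) / d ^ 2)
       + a * exp (- Q i) * exp (P i) - b = 0) ->
  forall i, (i <= n)%nat -> Rabs (p' i - P' i) <= (1 + k * Lam) * G + k * rho.
Proof.
  intros HM HG H0 Hn Hp HP.
  assert (HLam : 0 <= Lam).
  { unfold Lam; pose proof (exp_pos (M + 1)); nra. }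
  set (lam := fun i => k * (1 / 2 * sigma ^ 2 * (INR i * d) ^ 2) / d ^ 2).
  assert (Hlam : forall i, 0 <= lam i).
  { intros i; unfold lam; apply Rdiv_le_0_compat; [| apply pow_lt, hd].
    pose proof (pow2_ge_0 sigma); pose proof (pow2_ge_0 (INR i * d)).
    apply Rmult_le_pos; [lra |]; apply Rmult_le_pos; lra. }
  set (R0 := fun i => (p' i - p i) / k - 1 / 2 * sigma ^ 2 * (INR i * d) ^ 2
         * ((p' (i - 1)%nat - 2 * p' i + p' (S i)) / d ^ 2)
       + a * exp (p i - q i) - b).
  (* The error equation times [k], with diffusion kept on the left: [r] collects the old error, the
     truncation error [R0] and the difference of the reaction terms. *)
  apply (discrete_max_principle n lam _ Hlam) with
    (r := fun i => p i - P i + k * (R0 i - a * (exp (p i - q i) - exp (P i - Q i)))).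
  - pose proof (Rmult_le_pos _ _ (Rlt_le _ _ hk) HLam).
    pose proof (Rmult_le_pos _ _ (Rlt_le _ _ hk) hrho); nra.
  - lra.
  - lra.
  - intros i Hi; split.
    + pose proof (HP i Hi) as E.
      rewrite (Rmult_assoc a), <- exp_plus, (Rplus_comm (- Q i)) in E.
      change (P i + - Q i) with (P i - Q i) in E.
      (* The two sides differ by [- k] times the residual of the scheme, which vanishes by [E]. *)
      apply Rminus_diag_uniq.
      match type of E with ?l = 0 => transitivity (- (k * l)) end;
        [| rewrite E; ring].
      unfold R0, lam; field; lra.
    + assert (Hin : (i <= n)%nat) by lia.
      destruct (HG i Hin) as [H1 H2].
      pose proof (exp_local_lipschitz M G _ _ _ _ hG1 (HM i Hin) H1 H2) as HL.
      pose proof (Hp i Hi) as HR; fold (R0 i) in HR.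
      apply Rabs_le_between in H1; apply Rabs_le_between in HL.
      apply Rabs_le_between in HR.
      pose proof (exp_pos (M + 1)) as Hexp.
      (* The [c] share of [Lam] is nonnegative slack here; in the second equation the [a] share
         is. *)
      assert (HcG : 0 <= c * (2 * exp (M + 1) * G)) by (repeat apply Rmult_le_pos; lra).
      replace ((1 + k * Lam) * G + k * rho)
        with (G + k * (rho + a * (2 * exp (M + 1) * G) + c * (2 * exp (M + 1) * G)))
        by (unfold Lam; ring).
      set (X := 2 * exp (M + 1) * G) in *.
      set (Y := exp (p i - q i) - exp (P i - Q i)) in *.
      assert (Ha1 : a * Y <= a * X) by (apply Rmult_le_compat_l; lra).
      assert (Ha2 : a * - X <= a * Y) by (apply Rmult_le_compat_l; lra).
      assert (Hk1 : k * (R0 i - a * Y) <= k * (rho + a * X + c * X))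
        by (apply Rmult_le_compat_l; lra).
      assert (Hk2 : k * - (rho + a * X + c * X) <= k * (R0 i - a * Y))
        by (apply Rmult_le_compat_l; lra).
      apply Rabs_le_between; lra.
Qed.

(** The update is explicit and local in space, so the bound holds node by node, without a maximum
    principle. *)
Lemma v_error_step (p q q' P Q Q' : R) :
  q - p <= M -> Rabs (p - P) <= G -> Rabs (q - Q) <= G ->
  Rabs ((q' - q) / k + c * exp (q - p) - c) <= rho ->
  (Q' - Q) / k + c * exp (- P) * exp Q - c = 0 ->
  Rabs (q' - Q') <= (1 + k * Lam) * G + k * rho.
Proof.
  intros HM H1 H2 HR E.
  pose proof (exp_local_lipschitz M G _ _ _ _ hG1 HM H2 H1) as HL.
  rewrite (Rmult_assoc c), <- exp_plus, (Rplus_comm (- P)) in E.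
  change (Q + - P) with (Q - P) in E.
  pose proof (exp_pos (M + 1)) as Hexp.
  assert (HaG : 0 <= a * (2 * exp (M + 1) * G)) by (repeat apply Rmult_le_pos; lra).
  replace ((1 + k * Lam) * G + k * rho)
    with (G + k * (rho + a * (2 * exp (M + 1) * G) + c * (2 * exp (M + 1) * G)))
    by (unfold Lam; ring).
  set (X := 2 * exp (M + 1) * G) in *.
  set (R0 := (q' - q) / k + c * exp (q - p) - c) in HR.
  assert (Eq : q' - Q' = q - Q + k * (R0 - c * (exp (q - p) - exp (Q - P)))).
  { apply Rminus_diag_uniq.
    match type of E with ?l = 0 => transitivity (- (k * l)) end;
      [| rewrite E; ring].
    unfold R0; field; lra. }
  rewrite Eq; clear Eq E.
  set (Y := exp (q - p) - exp (Q - P)) in *.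
  apply Rabs_le_between in H2; apply Rabs_le_between in HL.
  apply Rabs_le_between in HR.
  assert (Ha1 : c * Y <= c * X) by (apply Rmult_le_compat_l; lra).
  assert (Ha2 : c * - X <= c * Y) by (apply Rmult_le_compat_l; lra).
  assert (Hk1 : k * (R0 - c * Y) <= k * (rho + a * X + c * X))
    by (apply Rmult_le_compat_l; lra).
  assert (Hk2 : k * - (rho + a * X + c * X) <= k * (R0 - c * Y))
    by (apply Rmult_le_compat_l; lra).
  apply Rabs_le_between; lra.
Qed.

End ErrorPropagation.

(** * Induction over time levels and the global estimate *)

Theorem theorem1
  (sigma gamma T Smax nu01 nu10 mu : R)
  (hsigma : 0 < sigma) (hgamma : 0 < gamma) (hT : 0 < T) (hSmax : 0 < Smax)
  (hnu01 : 0 < nu01) (hnu10 : 0 < nu10)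
  (h phil phir : R -> R) (u v : R -> R -> R) :
  let d0 := mu ^ 2 / (2 * sigma ^ 2) in
  let a := nu01 in
  let b := d0 + nu01 in
  let c := nu10 in
  C24 T Smax u -> C24 T Smax v ->
  classical_solution sigma gamma T Smax a b c h phil phir u v ->
  exists K delta : R, 0 < K /\ 0 < delta /\
    forall (nI nJ : nat) (ds dtau : R) (U V : nat -> nat -> R),
      (2 <= nI)%nat -> (1 <= nJ)%nat ->
      INR nI * ds = Smax -> INR nJ * dtau = T ->
      ds <= delta -> dtau <= delta ->
      imex_scheme sigma gamma a b c h phil phir nI nJ ds dtau U V ->
      grid_error nI nJ ds dtau u U + grid_error nI nJ ds dtau v V
        <= K * (dtau + ds ^ 2).
Proof.
  intros d0 a b c Cu Cv
    [[u_tau [u_s [u_ss [v_tau [Dut [Dus [Duss [Dvt Eq]]]]]]]] [Hinit Hbdry]].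
  fold a in hnu01; fold c in hnu10.
  clearbody b a c; clear d0.
  destruct (u_consistency sigma T Smax a b u v hT hSmax hnu01 Cu Cv _ _ _
              Dut Dus Duss (fun t s Hq => proj1 (Eq t s Hq))) as [Ku [Ku0 HKu]].
  destruct (v_consistency T Smax c u v hT Cv _
              Dvt (fun t s Hq => proj2 (Eq t s Hq))) as [Kv [Kv0 HKv]].
  destruct (C24_bounded _ _ _ Cu) as [Mu [Mu0 HMu]].
  destruct (C24_bounded _ _ _ Cv) as [Mv [Mv0 HMv]].
  set (M := Mu + Mv).
  set (K0 := Ku + Kv).
  set (Lam := 2 * exp (M + 1) * (a + c)).
  assert (HLam : 0 <= Lam).
  { unfold Lam; pose proof (exp_pos (M + 1)); nra. }
  (* The Gronwall bound at the final time, per unit of [dtau + ds ^ 2]. *)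
  set (C := K0 * T * exp (Lam * T)).
  assert (HC : 0 <= C).
  { unfold C, K0; pose proof (exp_pos (Lam * T)); apply Rmult_le_pos; nra. }
  (* As [delta < 1], [ds ^ 2 <= ds] and hence [eta <= 2 * delta]; the factor 4 then gives
     [2 * (C * eta) <= 1]. *)
  set (delta := / (4 * (C + 1))).
  assert (Hdelta : 0 < delta) by (apply Rinv_0_lt_compat; lra).
  assert (HCdelta : 4 * (C + 1) * delta = 1) by (apply Rinv_r; lra).
  (* Each of the two maxima contributes [C]; the added 1 makes the constant positive. *)
  exists (2 * C + 1), delta; split; [lra |]; split; [exact Hdelta |].
  intros nI nJ ds dtau U V HnI HnJ HI HJ Hds Hdt [HU [HV [HUV0 HUb]]].
  assert (HnI0 : 0 < INR nI) by (apply lt_0_INR; lia).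
  assert (HnJ0 : 0 < INR nJ) by (apply lt_0_INR; lia).
  assert (Hds0 : 0 < ds) by nra.
  assert (Hdt0 : 0 < dtau) by nra.
  set (eta := dtau + ds ^ 2).
  assert (Heta0 : 0 < eta) by (unfold eta; pose proof (pow_lt ds 2 Hds0); lra).
  assert (HCeta : 2 * (C * eta) <= 1).
  { assert (eta <= 2 * delta) by (unfold eta; nra).
    nra. }
  assert (HgridS : forall i, (i <= nI)%nat -> 0 <= INR i * ds <= Smax).
  { intros i Hi; pose proof (pos_INR i); apply le_INR in Hi; nra. }
  assert (HgridT : forall j, (j <= nJ)%nat -> 0 <= INR j * dtau <= T).
  { intros j Hj; pose proof (pos_INR j); apply le_INR in Hj; nra. }
  set (G := fun t => K0 * eta * t * exp (Lam * t)).
  assert (HK0eta : 0 <= K0 * eta) by (unfold K0; nra).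
  assert (HG0 : forall t, 0 <= t -> 0 <= G t).
  { intros t Ht; pose proof (exp_pos (Lam * t)).
    unfold G; repeat apply Rmult_le_pos; lra || (unfold K0; lra). }
  assert (HGC : forall t, 0 <= t <= T -> G t <= C * eta).
  { intros t Ht; unfold G, C.
    replace (K0 * T * exp (Lam * T) * eta) with (K0 * eta * T * exp (Lam * T)) by ring.
    apply Rmult_le_compat.
    - nra.
    - apply Rlt_le, exp_pos.
    - apply Rmult_le_compat_l; lra.
    - apply exp_le_exp, Rmult_le_compat_l; lra. }
  (* Both errors are carried together over all nodes of a time level, because the reaction terms
     couple them. *)
  assert (Herr : forall j, (j <= nJ)%nat -> forall i, (i <= nI)%nat ->
    Rabs (u (INR j * dtau) (INR i * ds) - U i j) <= G (INR j * dtau) /\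
    Rabs (v (INR j * dtau) (INR i * ds) - V i j) <= G (INR j * dtau)).
  { induction j as [|j IH]; intros Hj.
    - intros i Hi.
      destruct (HUV0 i Hi) as [-> ->].
      cbn [INR]; rewrite Rmult_0_l.
      destruct (Hinit _ (HgridS i Hi)) as [-> ->].
      rewrite Rminus_diag, Rabs_R0; split; apply HG0; lra.
    - specialize (IH ltac:(lia)).
      assert (Htj := HgridT j ltac:(lia)).
      assert (HtSj := HgridT (S j) Hj).
      destruct (HUb (S j) Hj) as [HUl HUr].
      rewrite S_INR, Rmult_plus_distr_r, Rmult_1_l in *.
      set (t := INR j * dtau) in *.
      (* The bound by [C * eta] holds for every time in [[0, T]], so the smallness required by the
         local Lipschitz estimate never degrades along the induction. *)
      assert (HG1 : 2 * G t <= 1) by (pose proof (HGC t Htj); lra).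
      assert (Hstep : (1 + dtau * Lam) * G t + dtau * (K0 * eta) <= G (t + dtau))
        by (apply gronwall_step; lra).
      (* An absolute value, because the two equations involve the exponents [u - v] and [v - u]. *)
      assert (HM : forall i, (i <= nI)%nat ->
        Rabs (u t (INR i * ds) - v t (INR i * ds)) <= M).
      { intros i Hi.
        assert (Hq : Q T Smax (t, INR i * ds))
          by (split; [exact Htj | apply HgridS, Hi]).
        pose proof (HMu _ _ Hq) as H1; pose proof (HMv _ _ Hq) as H2.
        apply Rabs_le_between in H1; apply Rabs_le_between in H2.
        unfold M; apply Rabs_le_between; lra. }
      intros i Hi; split; eapply Rle_trans; try exact Hstep.
      + apply (u_error_step sigma a b c ds dtau nI M (G t) (K0 * eta)
          hnu01 hnu10 Hds0 Hdt0 (HG0 t (proj1 Htj)) HG1 HK0eta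
          (fun i => u t (INR i * ds)) (fun i => v t (INR i * ds))
          (fun i => u (t + dtau) (INR i * ds))
          (fun i => U i j) (fun i => V i j) (fun i => U i (S j))); try assumption.
        * intros m Hm; specialize (HM m Hm); apply Rabs_le_between in HM; lra.
        * rewrite HUl; cbn [INR]; rewrite Rmult_0_l; apply (Hbdry _ HtSj).
        * rewrite HUr, HI; apply (Hbdry _ HtSj).
        * intros m Hm.
          assert (Hl := HgridS (m - 1)%nat ltac:(lia)).
          assert (Hr := HgridS (S m) ltac:(lia)).
          (* Interior indices satisfy [m >= 1], so the truncated subtraction is exact and the
             neighbours are the nodes at distance [ds]. *)
          assert (El : INR (m - 1) * ds = INR m * ds - ds)
            by (rewrite minus_INR by lia; cbn [INR]; ring).
          assert (Er : INR (S m) * ds = INR m * ds + ds) by (rewrite S_INR; ring).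
          rewrite El in Hl |- *; rewrite Er in Hr |- *.
          apply Rle_trans with (Ku * eta); [apply HKu; lra | unfold K0; nra].
        * intros m Hm; apply HU; lia.
      + destruct (IH i Hi) as [H1 H2].
        apply (v_error_step a c dtau M (G t) (K0 * eta) hnu01 hnu10 Hdt0
          (HG0 t (proj1 Htj)) HG1 (u t (INR i * ds)) (v t (INR i * ds))
          _ (U i j) (V i j)); try assumption.
        * specialize (HM i Hi); apply Rabs_le_between in HM; lra.
        * apply Rle_trans with (Kv * dtau).
          -- apply HKv; try lra; apply HgridS, Hi.
          -- pose proof (pow2_ge_0 ds); unfold K0, eta; nra.
        * apply HV; lia. }
  assert (HUerr : grid_error nI nJ ds dtau u U <= C * eta).
  { apply max_upto_le; intros i Hi; apply max_upto_le; intros j Hj.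
    eapply Rle_trans; [apply (Herr j Hj i Hi) | apply HGC, HgridT, Hj]. }
  assert (HVerr : grid_error nI nJ ds dtau v V <= C * eta).
  { apply max_upto_le; intros i Hi; apply max_upto_le; intros j Hj.
    eapply Rle_trans; [apply (Herr j Hj i Hi) | apply HGC, HgridT, Hj]. }
  lra.
Qed.
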